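(* Let $\mathcal Z_{r_1}=\{\zeta\in\mathbb R^L:\|\zeta\|_2\le\Omega_{r_1}\}$ ($r_1=1,\dots,s_1$), $\mathcal Z_{r_2}=\{\zeta\in\mathbb R^L:\|\zeta\|_2\le\Omega_{r_2}\}$ ($r_2=1,\dots,s_2$) and $\mathcal Z_d=\{\zeta\in\mathbb R^L:\|\zeta\|_2\le\Omega_d\}$ ($d=1,\dots,D$). Then the second stage robust SBM model with these ellipsoidal uncertainty sets is equivalent to the following polynomial-size second order conic optimization problem: $$\max\ w_k^2$$ subject to $$w_k^2-p_2-\frac1{s_1+s_2}\Big(\sum_{r_1=1}^{s_1}c^D_{r_1k}-\sum_{r_2=1}^{s_2}c^U_{r_2k}\Big)\le 0,\qquad p_2-\frac1D\sum_{d=1}^{D}b_{dk}\le 1,$$ $$-p_2z_{dk}^0+\sum_{j=1}^{n}z_{dj}^0\lambda_j'+S_{dk}+\Omega_d\sqrt{\sum_{\ell=1}^{L}\Big(\sum_{j=1}^{n}z_{dj}^\ell\lambda_j'-p_2z_{dk}^\ell\Big)^2}\le 0\ \ \forall d,$$ $$p_2y_{r_1k}^{D,0}-\sum_{j=1}^{n}y_{r_1j}^{D,0}\lambda_j'+S^D_{r_1k}+\Omega_{r_1}\sqrt{\sum_{\ell=1}^{L}\Big(p_2y_{r_1k}^{D,\ell}-\sum_{j=1}^{n}y_{r_1j}^{D,\ell}\lambda_j'\Big)^2}\le 0\ \ \forall r_1,$$ $$-p_2y_{r_2k}^{U,0}+\sum_{j=1}^{n}y_{r_2j}^{U,0}\lambda_j'+S^U_{r_2k}+\Omega_{r_2}\sqrt{\sum_{\ell=1}^{L}\Big(\sum_{j=1}^{n}y_{r_2j}^{U,\ell}\lambda_j'-p_2y_{r_2k}^{U,\ell}\Big)^2}\le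 0\ \ \forall r_2,$$ $$p_2-\sum_{j=1}^{n}\lambda_j'=0,\qquad y_{r_1k}^{D,0}c^D_{r_1k}-S^D_{r_1k}+\Omega_{r_1}\sqrt{\sum_{\ell=1}^{L}(y_{r_1k}^{D,\ell}c^D_{r_1k})^2}\le 0\ \ \forall r_1,$$ $$y_{r_2k}^{U,0}c^U_{r_2k}-S^U_{r_2k}+\Omega_{r_2}\sqrt{\sum_{\ell=1}^{L}(y_{r_2k}^{U,\ell}c^U_{r_2k})^2}\le 0\ \ \forall r_2,\qquad z_{dk}^0b_{dk}-S_{dk}+\Omega_d\sqrt{\sum_{\ell=1}^{L}(z_{dk}^\ell b_{dk})^2}\le 0\ \ \forall d,$$ $$p_2>0,\quad\lambda_j'\ge 0\ \forall j,\quad S_{dk}\ge 0\ \forall d,\quad S^D_{r_1k}\ge 0\ \forall r_1,\quad S^U_{r_2k}\ge 0\ \forall r_2.$$ (Equivalent: the two problems, which have the same variables and objective, have the same feasible set.)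
   Context: There are $n$ decision-making units $DMU_1,\dots,DMU_n$, and $k\in\{1,\dots,n\}$ is fixed. Intermediates $z_{dj}$ ($d=1,\dots,D$), desirable outputs $y^D_{r_1j}$ ($r_1=1,\dots,s_1$) and undesirable outputs $y^U_{r_2j}$ ($r_2=1,\dots,s_2$) of $DMU_j$ depend affinely on a perturbation vector $\zeta\in\mathbb R^L$: $z_{dj}(\zeta)=z_{dj}^0+\sum_{\ell}\zeta_\ell z_{dj}^\ell$, $y^D_{r_1j}(\zeta)=y_{r_1j}^{D,0}+\sum_\ell\zeta_\ell y_{r_1j}^{D,\ell}$, $y^U_{r_2j}(\zeta)=y_{r_2j}^{U,0}+\sum_\ell\zeta_\ell y_{r_2j}^{U,\ell}$, $\ell=1,\dots,L$, with real nominal values and deviations. The radii $\Omega_{r_1},\Omega_{r_2},\Omega_d\ge 0$ are robustness parameters. The second stage robust SBM model with uncertainty sets $\mathcal Z_{r_1},\mathcal Z_{r_2},\mathcal Z_d\subset\mathbb R^L$ is: maximize $w_k^2$ subject to - $w_k^2-p_2-\frac1{s_1+s_2}\big(\sum_{r_1}c^D_{r_1k}-\sum_{r_2}c^U_{r_2k}\big)\le 0$ and $p_2-\frac1D\sum_d b_{dk}\le 1$; - $p_2z_{dk}(\zeta)-\sum_jz_{dj}(\zeta)\lambda_j'-S_{dk}\ge 0$ and $z_{dk}(\zeta)b_{dk}-S_{dk}\le 0$, each for all $\zeta\in\mathcal Z_d$, for every $d$; - $p_2y^D_{r_1k}(\zeta)-\sum_jy^D_{r_1j}(\zeta)\lambda_j'+S^D_{r_1k}\le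 0$ and $y^D_{r_1k}(\zeta)c^D_{r_1k}-S^D_{r_1k}\le 0$, each for all $\zeta\in\mathcal Z_{r_1}$, for every $r_1$; - $-p_2y^U_{r_2k}(\zeta)+\sum_jy^U_{r_2j}(\zeta)\lambda_j'+S^U_{r_2k}\le 0$ and $y^U_{r_2k}(\zeta)c^U_{r_2k}-S^U_{r_2k}\le 0$, each for all $\zeta\in\mathcal Z_{r_2}$, for every $r_2$; - $p_2-\sum_j\lambda_j'=0$, $p_2>0$, $\lambda_j'\ge 0$, $S_{dk}\ge 0$, $S^D_{r_1k}\ge 0$, $S^U_{r_2k}\ge 0$. Decision variables: real $w_k^2,p_2,\lambda_j',S_{dk},b_{dk},S^D_{r_1k},c^D_{r_1k},S^U_{r_2k},c^U_{r_2k}$. *)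

(* Defs.v *)
From HB Require Import structures.
From mathcomp Require Import all_boot all_order all_algebra.
From mathcomp Require Import classical_sets reals.

Set Implicit Arguments.
Unset Strict Implicit.
Unset Printing Implicit Defensive.

Import Order.TTheory GRing.Theory Num.Theory.
Local Open Scope classical_set_scope.
Local Open Scope ring_scope.

(* The library norm on matrices is the sup norm, hence this definition. *)
Definition norm2 (R : realType) (m : nat) (v : 'rV[R]_m) : R :=
  Num.sqrt (\sum_(i < m) v 0 i ^+ 2).

Definition ball2 (R : realType) (L : nat) (Omega : R) : set 'rV[R]_L :=
  [set zeta | norm2 zeta <= Omega].

Record max_problem (R : realType) (V : Type) := MaxProblem {
  objective : V -> R;
  feasible : set V }.

Definition equivalent_problems (R : realType) (V : Type)
    (P Q : max_problem R V) : Prop :=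
  (forall x, objective P x = objective Q x) /\
  (forall x, feasible P x <-> feasible Q x).

(* Measure i of unit j, affine in the perturbation zeta: the coefficient of
   zeta_l is [deviation a l i j]. *)
Record uncertain (R : realType) (m n L : nat) := Uncertain {
  nominal : 'I_m -> 'I_n -> R;
  deviation : 'I_L -> 'I_m -> 'I_n -> R }.

Definition realization (R : realType) (m n L : nat) (a : uncertain R m n L)
    (i : 'I_m) (j : 'I_n) (zeta : 'rV[R]_L) : R :=
  nominal a i j + \sum_(l < L) zeta 0 l * deviation a l i j.

Record sbm_data (R : realType) (n D s1 s2 L : nat) := SBMData {
  interm : uncertain R D n L;
  desir : uncertain R s1 n L;
  undesir : uncertain R s2 n L }.

Record sbm_vars (R : realType) (n D s1 s2 : nat) := SBMVars {
  var_w : R;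
  var_p2 : R;
  var_lam : 'I_n -> R;
  var_S : 'I_D -> R;
  var_b : 'I_D -> R;
  var_SD : 'I_s1 -> R;
  var_cD : 'I_s1 -> R;
  var_SU : 'I_s2 -> R;
  var_cU : 'I_s2 -> R }.

(* Empty index families are not excluded: 0^-1 = 0 makes the averages over
   them vanish, here and in [ellipsoidal_counterpart]. *)
Definition robust_sbm (R : realType) (n D s1 s2 L : nat)
    (I : sbm_data R n D s1 s2 L) (k : 'I_n)
    (ZD : 'I_s1 -> set 'rV[R]_L) (ZU : 'I_s2 -> set 'rV[R]_L)
    (Z : 'I_D -> set 'rV[R]_L) : max_problem R (sbm_vars R n D s1 s2) :=
  let z := realization (interm I) in
  let yD := realization (desir I) in
  let yU := realization (undesir I) in
  MaxProblem (@var_w R n D s1 s2) [set x |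
    let: SBMVars w p2 lam Sd b SD cD SU cU := x in
    (w - p2 - (s1 + s2)%:R^-1 * (\sum_(r < s1) cD r - \sum_(r < s2) cU r) <= 0)
    /\ (p2 - D%:R^-1 * \sum_(d < D) b d <= 1)
    /\ (forall d zeta, Z d zeta ->
          p2 * z d k zeta - \sum_(j < n) z d j zeta * lam j - Sd d >= 0)
    /\ (forall d zeta, Z d zeta -> z d k zeta * b d - Sd d <= 0)
    /\ (forall r zeta, ZD r zeta ->
          p2 * yD r k zeta - \sum_(j < n) yD r j zeta * lam j + SD r <= 0)
    /\ (forall r zeta, ZD r zeta -> yD r k zeta * cD r - SD r <= 0)
    /\ (forall r zeta, ZU r zeta ->
          - p2 * yU r k zeta + \sum_(j < n) yU r j zeta * lam j + SU r <= 0)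
    /\ (forall r zeta, ZU r zeta -> yU r k zeta * cU r - SU r <= 0)
    /\ p2 - \sum_(j < n) lam j = 0
    /\ p2 > 0
    /\ (forall j, lam j >= 0)
    /\ (forall d, Sd d >= 0)
    /\ (forall r, SD r >= 0)
    /\ (forall r, SU r >= 0)].

Definition ellipsoidal_counterpart (R : realType) (n D s1 s2 L : nat)
    (I : sbm_data R n D s1 s2 L) (k : 'I_n)
    (OmegaD : 'I_s1 -> R) (OmegaU : 'I_s2 -> R) (Omega : 'I_D -> R) :
    max_problem R (sbm_vars R n D s1 s2) :=
  let z0 := nominal (interm I) in let zl := deviation (interm I) in
  let yD0 := nominal (desir I) in let yDl := deviation (desir I) in
  let yU0 := nominal (undesir I) in let yUl := deviation (undesir I) in
  MaxProblem (@var_w R n D s1 s2) [set x |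
    let: SBMVars w p2 lam Sd b SD cD SU cU := x in
    (w - p2 - (s1 + s2)%:R^-1 * (\sum_(r < s1) cD r - \sum_(r < s2) cU r) <= 0)
    /\ (p2 - D%:R^-1 * \sum_(d < D) b d <= 1)
    /\ (forall d, - p2 * z0 d k + \sum_(j < n) z0 d j * lam j + Sd d
          + Omega d * Num.sqrt (\sum_(l < L)
              (\sum_(j < n) zl l d j * lam j - p2 * zl l d k) ^+ 2) <= 0)
    /\ (forall r, p2 * yD0 r k - \sum_(j < n) yD0 r j * lam j + SD r
          + OmegaD r * Num.sqrt (\sum_(l < L)
              (p2 * yDl l r k - \sum_(j < n) yDl l r j * lam j) ^+ 2) <= 0)
    /\ (forall r, - p2 * yU0 r k + \sum_(j < n) yU0 r j * lam j + SU r
          + OmegaU r * Num.sqrt (\sum_(l < L)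
              (\sum_(j < n) yUl l r j * lam j - p2 * yUl l r k) ^+ 2) <= 0)
    /\ p2 - \sum_(j < n) lam j = 0
    /\ (forall r, yD0 r k * cD r - SD r
          + OmegaD r * Num.sqrt (\sum_(l < L) (yDl l r k * cD r) ^+ 2) <= 0)
    /\ (forall r, yU0 r k * cU r - SU r
          + OmegaU r * Num.sqrt (\sum_(l < L) (yUl l r k * cU r) ^+ 2) <= 0)
    /\ (forall d, z0 d k * b d - Sd d
          + Omega d * Num.sqrt (\sum_(l < L) (zl l d k * b d) ^+ 2) <= 0)
    /\ p2 > 0
    /\ (forall j, lam j >= 0)
    /\ (forall d, Sd d >= 0)
    /\ (forall r, SD r >= 0)
    /\ (forall r, SU r >= 0)].

(* The constraint |u A + b|_2 <= u c + d on row vectors u; a linear inequality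
   is the case [soc_rank = 0], an equation is a pair of these. *)
Record soc_constraint (R : realType) (N : nat) := SOCConstraint {
  soc_rank : nat;
  soc_A : 'M[R]_(N, soc_rank);
  soc_b : 'rV[R]_soc_rank;
  soc_c : 'cV[R]_N;
  soc_d : R }.

Definition soc_holds (R : realType) (N : nat) (u : 'rV[R]_N)
    (C : soc_constraint R N) : bool :=
  norm2 (u *m soc_A C + soc_b C) <= (u *m soc_c C) 0 0 + soc_d C.

(* Strict linear inequalities 0 < u c + d are allowed besides the conic ones,
   because the SBM model has the constraint p_2 > 0. *)
Record socp (R : realType) (N : nat) := SOCP {
  socp_obj : 'cV[R]_N;
  socp_cones : seq (soc_constraint R N);
  socp_strict : seq ('cV[R]_N * R) }.

Definition socp_problem (R : realType) (N : nat) (P : socp R N) :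
    max_problem R 'rV[R]_N :=
  MaxProblem (fun u => (u *m socp_obj P) 0 0)
    [set u | all (soc_holds u) (socp_cones P) &&
             all (fun cd => 0 < (u *m cd.1) 0 0 + cd.2) (socp_strict P)].

(* The number of real coefficients in the data of the program. *)
Definition socp_size (R : realType) (N : nat) (P : socp R N) : nat :=
  (N + \sum_(C <- socp_cones P) (soc_rank C).+1 * N.+1
     + size (socp_strict P) * N.+1)%N.

Definition sbm_dim (n D s1 s2 : nat) : nat :=
  (1 + (1 + (n + (D + (D + (s1 + (s1 + (s2 + s2))))))))%N.

Definition sbm_coords (R : realType) (n D s1 s2 : nat)
    (x : sbm_vars R n D s1 s2) : 'rV[R]_(sbm_dim n D s1 s2) :=
  row_mx (\row_(_ < 1) var_w x) (row_mx (\row_(_ < 1) var_p2 x)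
  (row_mx (\row_j var_lam x j) (row_mx (\row_d var_S x d)
  (row_mx (\row_d var_b x d) (row_mx (\row_r var_SD x r)
  (row_mx (\row_r var_cD x r) (row_mx (\row_r var_SU x r)
  (\row_r var_cU x r)))))))).

(* P is, up to the coordinates [sbm_coords] on its variables, a second order
   conic program whose data have at most [B] coefficients. *)
Definition is_socp_of_size (R : realType) (n D s1 s2 : nat) (B : nat)
    (P : max_problem R (sbm_vars R n D s1 s2)) : Prop :=
  exists2 Q : socp R (sbm_dim n D s1 s2), (socp_size Q <= B)%N &
    forall x, objective P x = objective (socp_problem Q) (sbm_coords x) /\
      (feasible P x <-> feasible (socp_problem Q) (sbm_coords x)).

(* Main.v *)
Require Import Defs.
From HB Require Import structures.
From mathcomp Require Import all_boot all_order all_algebra.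
From mathcomp Require Import classical_sets reals.
From mathcomp Require Import ring lra zify.

Set Implicit Arguments.
Unset Strict Implicit.
Unset Printing Implicit Defensive.

Import Order.TTheory GRing.Theory Num.Theory.
Local Open Scope ring_scope.

(** The theorem rests on two independent facts.

    Robust constraints: every constraint of the robust problem is affine in the
    perturbation, hence reads [a0 + <zeta, a> <= 0] for all [zeta] in a Euclidean
    ball of radius [Omega], where [a0] and [a] depend on the decision variables.
    By Cauchy-Schwarz the maximum of [<zeta, a>] over that ball is [Omega * |a|],
    attained at the multiple [(Omega / |a|) a] of [a], so the infinitely many
    inequalities amount to [a0 + Omega * |a| <= 0] ([robust_ball2P]).  This is done
    constraint by constraint; only the way in which the realizations of an
    uncertain measure expand in [zeta] has to be computed ([realization_gap]).

    Conic form: [a0] and the entries of [a] are affine in the decision variables,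
    so [a0 + Omega * |a| <= 0] is the second order cone constraint
    [|Omega a| <= - a0]; the factor [Omega >= 0] is absorbed in the matrix.
    Sets described by conic constraints are closed under conjunction and under
    finite universal quantification, with additive cost ([socp_set_and],
    [socp_set_forall]).  With [T = n + D + s1 + s2 + L + 1], there are [O(T)]
    constraints, each of rank at most [L], in [O(T)] variables, which gives
    [O(T ^ 3)] coefficients. *)

(** * Linear constraints over a Euclidean ball *)

(** Cauchy-Schwarz for a vector [z] of norm at most [Omega].  With [N = |a|], the
    inequality [2 (N z_l) (Omega a_l) <= (N z_l)^2 + (Omega a_l)^2] sums to
    [2 Omega N <z, a> <= 2 (Omega N)^2], which can be divided by [Omega N] unless
    [a] or [z] vanishes. *)
Lemma dot_le_norm2 (R : realType) (L : nat) (Omega : R) (z : 'rV[R]_L)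
    (a : 'I_L -> R) :
  norm2 z <= Omega ->
  \sum_(l < L) z 0 l * a l <= Omega * Num.sqrt (\sum_(l < L) a l ^+ 2).
Proof.
rewrite /norm2 => zle.
have sumsq_ge0 (u : 'I_L -> R) : 0 <= \sum_(l < L) u l ^+ 2.
  by apply: sumr_ge0 => l _; apply: sqr_ge0.
have sumsq_eq0 (u : 'I_L -> R) : \sum_(l < L) u l ^+ 2 <= 0 -> forall l, u l = 0.
  move=> u_le0 l; have /psumr_eq0P u0 : \sum_(l < L) u l ^+ 2 = 0.
    by apply/eqP; rewrite eq_le u_le0 sumsq_ge0.
  by apply/eqP; rewrite -sqrf_eq0; apply/eqP/u0 => // i _; apply: sqr_ge0.
have O0 : 0 <= Omega by apply: le_trans zle; apply: sqrtr_ge0.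
set N := Num.sqrt _.
have N0 : 0 <= N by apply: sqrtr_ge0.
have N2 : \sum_(l < L) a l ^+ 2 = N ^+ 2 by rewrite sqr_sqrtr.
have z2 : \sum_(l < L) z 0 l ^+ 2 <= Omega ^+ 2.
  by rewrite -[leLHS]sqr_sqrtr // ler_sqr ?nnegrE ?sqrtr_ge0.
have [ON0|ON_gt0] := leP (Omega * N) 0.
  have /eqP : Omega * N = 0 by apply/eqP; rewrite eq_le ON0 mulr_ge0.
  rewrite mulf_eq0 => /orP[]/eqP E0.
    rewrite E0 mul0r big1 // => l _; rewrite (sumsq_eq0 (z 0)) ?mul0r //.
    by apply: le_trans z2 _; rewrite E0 expr0n.
  rewrite E0 mulr0 big1 // => l _; rewrite (sumsq_eq0 a) ?mulr0 //.
  by rewrite N2 E0 expr0n.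
have : \sum_(l < L) 2 * (Omega * N) * (z 0 l * a l) <=
       \sum_(l < L) (N ^+ 2 * z 0 l ^+ 2 + Omega ^+ 2 * a l ^+ 2).
  apply: ler_sum => l _; rewrite -subr_ge0.
  have -> : N ^+ 2 * z 0 l ^+ 2 + Omega ^+ 2 * a l ^+ 2 -
     2 * (Omega * N) * (z 0 l * a l) = (N * z 0 l - Omega * a l) ^+ 2 by ring.
  exact: sqr_ge0.
rewrite big_split /= -!mulr_sumr N2 => le1.
have le2 : N ^+ 2 * (\sum_(l < L) z 0 l ^+ 2) <= N ^+ 2 * Omega ^+ 2.
  by rewrite ler_wpM2l // sqr_ge0.
rewrite -(ler_pM2l ON_gt0); nra.
Qed.

(** Necessity uses a single perturbation, the one for which Cauchy-Schwarz is an
    equality.  The predicate [P] is kept abstract because the constraints of the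
    model become [a0 + <zeta, a> <= 0] only after rearrangement. *)
Lemma robust_ball2P (R : realType) (L : nat) (Omega a0 : R) (a : 'I_L -> R)
    (P : 'rV[R]_L -> Prop) :
  0 <= Omega ->
  (forall zeta, P zeta <-> a0 + \sum_(l < L) zeta 0 l * a l <= 0) ->
  (forall zeta, @ball2 R L Omega zeta -> P zeta) <->
  a0 + Omega * Num.sqrt (\sum_(l < L) a l ^+ 2) <= 0.
Proof.
move=> O0 PE; split=> [allP|le0 zeta zetaB]; last first.
  by apply/PE; apply: le_trans le0; rewrite lerD2l dot_le_norm2.
set S := \sum_(l < L) _; set N := Num.sqrt S.
have N0 : 0 <= N by apply: sqrtr_ge0.
have S0 : 0 <= S by apply: sumr_ge0 => l _; apply: sqr_ge0.
have SE : S = N * N by rewrite -expr2 sqr_sqrtr.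
(* When [a = 0] the inverse of [N] is 0 and the worst case is taken at 0. *)
pose t := Omega / N.
have t0 : 0 <= t by rewrite divr_ge0.
have zB : @ball2 R L Omega (\row_l (t * a l)).
  rewrite /ball2 /= /norm2.
  under eq_bigr do rewrite mxE exprMn.
  rewrite -mulr_sumr -/S sqrtrM ?sqr_ge0 // sqrtr_sqr ger0_norm // -/N /t.
  by have [->|Nn0] := eqVneq N 0; rewrite ?mulr0 ?divfK.
have := (PE _).1 (allP _ zB).
under eq_bigr do rewrite mxE -mulrA -expr2.
rewrite -mulr_sumr -/S SE /t mulrA.
by have [->|Nn0] := eqVneq N 0; rewrite ?mulr0 ?divfK.
Qed.

Lemma robust_ball2_allP (R : realType) (m L : nat) (Omega a0 : 'I_m -> R)
    (a : 'I_m -> 'I_L -> R) (P : 'I_m -> 'rV[R]_L -> Prop) :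
  (forall i, 0 <= Omega i) ->
  (forall i zeta, P i zeta <-> a0 i + \sum_(l < L) zeta 0 l * a i l <= 0) ->
  (forall i zeta, @ball2 R L (Omega i) zeta -> P i zeta) <->
  (forall i, a0 i + Omega i * Num.sqrt (\sum_(l < L) a i l ^+ 2) <= 0).
Proof.
by move=> O0 PE; split=> H i; apply/(robust_ball2P (O0 i) (PE i)); apply: H.
Qed.

(** * Realizations as affine functions of the perturbation *)

Lemma realizationM (R : realType) (m n L : nat) (a : uncertain R m n L)
    (i : 'I_m) (j : 'I_n) (c : R) (zeta : 'rV[R]_L) :
  realization a i j zeta * c =
  nominal a i j * c + \sum_(l < L) zeta 0 l * (deviation a l i j * c).
Proof.
rewrite /realization mulrDl mulr_suml; congr (_ + _).
by apply: eq_bigr => l _; rewrite mulrA.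
Qed.

(** The gap between [p] times unit [k] and the combination of all units with
    weights [lam], which is the uncertain part of every envelopment constraint. *)
Lemma realization_gap (R : realType) (m n L : nat) (a : uncertain R m n L)
    (i : 'I_m) (k : 'I_n) (p : R) (lam : 'I_n -> R) (zeta : 'rV[R]_L) :
  p * realization a i k zeta - \sum_(j < n) realization a i j zeta * lam j =
  (p * nominal a i k - \sum_(j < n) nominal a i j * lam j) +
  \sum_(l < L) zeta 0 l *
     (p * deviation a l i k - \sum_(j < n) deviation a l i j * lam j).
Proof.
under eq_bigr do rewrite realizationM.
rewrite big_split /= exchange_big /= [p * realization _ _ _ _]mulrC realizationM.
under [in X in _ = _ + X]eq_bigr do rewrite mulrBr mulr_sumr [p * _]mulrC.
by rewrite sumrB; ring.
Qed.

Lemma robust_sbm_counterpart (R : realType) (n D s1 s2 L : nat)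
    (I : sbm_data R n D s1 s2 L) (k : 'I_n)
    (OmegaD : 'I_s1 -> R) (OmegaU : 'I_s2 -> R) (Omega : 'I_D -> R) :
  (forall r, 0 <= OmegaD r) ->
  (forall r, 0 <= OmegaU r) ->
  (forall d, 0 <= Omega d) ->
  equivalent_problems
    (robust_sbm I k (fun r => @ball2 R L (OmegaD r))
                    (fun r => @ball2 R L (OmegaU r))
                    (fun d => @ball2 R L (Omega d)))
    (ellipsoidal_counterpart I k OmegaD OmegaU Omega).
Proof.
move=> OD0 OU0 O0; split=> [//|[w p2 lam S b SD cD SU cU]].
(* The constraint on the intermediates is a lower bound, and the one on the
   undesirable outputs carries the opposite of the gap: for both, the
   coefficients of [zeta] are those of [realization_gap] with signs reversed. *)
have Ez := robust_ball2_allP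
  (P := fun d zeta => 0 <= p2 * realization (interm I) d k zeta
     - \sum_(j < n) realization (interm I) d j zeta * lam j - S d)
  (a0 := fun d => - p2 * nominal (interm I) d k
     + \sum_(j < n) nominal (interm I) d j * lam j + S d)
  (a := fun d l => \sum_(j < n) deviation (interm I) l d j * lam j
     - p2 * deviation (interm I) l d k) O0.
have EyD := robust_ball2_allP
  (P := fun r zeta => p2 * realization (desir I) r k zeta
     - \sum_(j < n) realization (desir I) r j zeta * lam j + SD r <= 0)
  (a0 := fun r => p2 * nominal (desir I) r k
     - \sum_(j < n) nominal (desir I) r j * lam j + SD r)
  (a := fun r l => p2 * deviation (desir I) l r k
     - \sum_(j < n) deviation (desir I) l r j * lam j) OD0.
have EyU := robust_ball2_allP
  (P := fun r zeta => - p2 * realization (undesir I) r k zeta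
     + \sum_(j < n) realization (undesir I) r j zeta * lam j + SU r <= 0)
  (a0 := fun r => - p2 * nominal (undesir I) r k
     + \sum_(j < n) nominal (undesir I) r j * lam j + SU r)
  (a := fun r l => \sum_(j < n) deviation (undesir I) l r j * lam j
     - p2 * deviation (undesir I) l r k) OU0.
have Ezb := robust_ball2_allP
  (P := fun d zeta => realization (interm I) d k zeta * b d - S d <= 0)
  (a0 := fun d => nominal (interm I) d k * b d - S d)
  (a := fun d l => deviation (interm I) l d k * b d) O0.
have EcD := robust_ball2_allP
  (P := fun r zeta => realization (desir I) r k zeta * cD r - SD r <= 0)
  (a0 := fun r => nominal (desir I) r k * cD r - SD r)
  (a := fun r l => deviation (desir I) l r k * cD r) OD0.
have EcU := robust_ball2_allP
  (P := fun r zeta => realization (undesir I) r k zeta * cU r - SU r <= 0)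
  (a0 := fun r => nominal (undesir I) r k * cU r - SU r)
  (a := fun r l => deviation (undesir I) l r k * cU r) OU0.
rewrite /= Ez ?EyD ?EyU ?Ezb ?EcD ?EcU; first by tauto.
all: move=> r zeta.
1-3: by rewrite realizationM; split=> H; lra.
- have gap := realization_gap (undesir I) r k p2 lam zeta.
  under [in X in _ <-> _ + X <= 0]eq_bigr do rewrite -opprB mulrN.
  by rewrite sumrN; split=> H; lra.
- have gap := realization_gap (desir I) r k p2 lam zeta.
  by split=> H; lra.
- have gap := realization_gap (interm I) r k p2 lam zeta.
  under [in X in _ <-> _ + X <= 0]eq_bigr do rewrite -opprB mulrN.
  by rewrite sumrN; split=> H; lra.
Qed.

(** * Sets of second order conic constraints *)

Section SocpSets.
Variables (R : realType) (V : Type) (N : nat) (phi : V -> 'rV[R]_N).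

Definition affine (f : V -> R) : Prop :=
  exists c : 'cV[R]_N, exists d : R, forall x, f x = (phi x *m c) 0 0 + d.

Lemma affine_coord i : affine (fun x => phi x 0 i).
Proof. by exists (delta_mx i 0), 0 => x; rewrite -colE mxE addr0. Qed.

Lemma affine_const a : affine (fun _ => a).
Proof. by exists 0, a => x; rewrite mulmx0 mxE add0r. Qed.

Lemma affineD f g : affine f -> affine g -> affine (fun x => f x + g x).
Proof.
move=> [c [d fE]] [c' [d' gE]]; exists (c + c'), (d + d') => x.
by rewrite fE gE mulmxDr [in RHS]mxE; ring.
Qed.

Lemma affineMl a f : affine f -> affine (fun x => a * f x).
Proof.
move=> [c [d fE]]; exists (a *: c), (a * d) => x.
by rewrite fE -scalemxAr [in RHS]mxE mulrDr.
Qed.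

Lemma eq_affine f g : affine f -> f =1 g -> affine g.
Proof. by move=> [c [d fE]] fg; exists c, d => x; rewrite -fg. Qed.

Lemma affineMr a f : affine f -> affine (fun x => f x * a).
Proof. by move=> /(affineMl a)/eq_affine; apply=> x; rewrite mulrC. Qed.

Lemma affineN f : affine f -> affine (fun x => - f x).
Proof. by move=> /(affineMl (-1))/eq_affine; apply=> x; rewrite mulN1r. Qed.

Lemma affineB f g : affine f -> affine g -> affine (fun x => f x - g x).
Proof. by move=> ? /affineN; apply: affineD. Qed.

Lemma affine_sum m (f : 'I_m -> V -> R) :
  (forall i, affine (f i)) -> affine (fun x => \sum_(i < m) f i x).
Proof.
move=> /fin_all_exists[c] /fin_all_exists[d fE].
exists (\sum_i c i), (\sum_i d i) => x.
by rewrite mulmx_sumr summxE -big_split; apply: eq_bigr => i _; apply: fE.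
Qed.

(** [F] is cut out, through the coordinates [phi], by conic and strict linear
    constraints of total cost [B].  A cone [|u A + b| <= u c + d] of rank [r] costs
    [r + 1], one for each affine form in it, and a strict inequality costs 1; an
    affine form has [N + 1] coefficients. *)
Definition socp_set (B : nat) (F : V -> Prop) : Prop :=
  exists cones : seq (soc_constraint R N), exists strict : seq ('cV[R]_N * R),
    (\sum_(C <- cones) (soc_rank C).+1 + size strict <= B)%N /\
    forall x, F x <-> all (soc_holds (phi x)) cones &&
      all (fun cd => 0 < (phi x *m cd.1) 0 0 + cd.2) strict.

Lemma eq_socp_set B F G :
  socp_set B F -> (forall x, G x <-> F x) -> socp_set B G.
Proof.
by move=> [cs [ss [leB FE]]] GF; exists cs, ss; split=> // x; rewrite GF FE.
Qed.

Lemma socp_set_and B B' F G : socp_set B F -> socp_set B' G ->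
  socp_set (B + B') (fun x => F x /\ G x).
Proof.
move=> [cs [ss [leB FE]]] [cs' [ss' [leB' GE]]].
exists (cs ++ cs'), (ss ++ ss'); split=> [|x].
  by rewrite big_cat size_cat addnACA leq_add.
rewrite !all_cat andbACA FE GE; split=> [[-> ->] //|/andP[]//].
Qed.

Lemma socp_set_forall m B (F : 'I_m -> V -> Prop) :
  (forall i, socp_set B (F i)) -> socp_set (m * B) (fun x => forall i, F i x).
Proof.
elim: m F => [|m IHm] F FB.
  by exists [::], [::]; split=> [|x]; [rewrite big_nil | split=> // _ []].
rewrite mulSn; apply: eq_socp_set (socp_set_and (FB ord0) (IHm _ _)) _.
  by move=> i; apply: (FB (lift ord0 i)).
move=> x; split=> [Fx|[F0 FS] i]; first by split=> [|i]; apply: Fx.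
by case: (unliftP ord0 i) => [j ->|->].
Qed.

Lemma socp_set_gt0 f : affine f -> socp_set 1 (fun x => 0 < f x).
Proof.
move=> [c [d fE]]; exists [::], [:: (c, d)]; split=> [|x /=].
  by rewrite big_nil.
by rewrite andbT fE.
Qed.

Lemma socp_set_cone m (g : 'I_m -> V -> R) h :
  (forall l, affine (g l)) -> affine h ->
  socp_set m.+1 (fun x => Num.sqrt (\sum_(l < m) g l x ^+ 2) <= h x).
Proof.
move=> /fin_all_exists[c] /fin_all_exists[d gE] [c' [d' hE]].
exists [:: SOCConstraint (\matrix_(i, l) c l i 0) (\row_l d l) c' d'], [::].
split=> [|x]; first by rewrite big_seq1 addn0.
rewrite /= !andbT /soc_holds /= -hE /norm2.
suff -> : \sum_(l < m) g l x ^+ 2 =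
  \sum_l (phi x *m (\matrix_(i, l) c l i 0) + \row_l d l) 0 l ^+ 2 by [].
apply: eq_bigr => l _; rewrite gE !mxE; congr ((_ + _) ^+ 2).
by apply: eq_bigr => i _; rewrite mxE.
Qed.

(** The shape that robust counterparts take: the radius is moved inside the norm
    as [Omega * |g| = |Omega g|]. *)
Lemma socp_set_robust m (g : 'I_m -> V -> R) f Omega : 0 <= Omega ->
  affine f -> (forall l, affine (g l)) ->
  socp_set m.+1
    (fun x => f x + Omega * Num.sqrt (\sum_(l < m) g l x ^+ 2) <= 0).
Proof.
move=> O0 fA gA.
apply: eq_socp_set
  (socp_set_cone (fun l => affineMl Omega (gA l)) (affineN fA)) _ => x.
under [in X in _ <-> X]eq_bigr do rewrite exprMn.
rewrite -mulr_sumr sqrtrM ?sqr_ge0 // sqrtr_sqr ger0_norm //.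
by split=> H; lra.
Qed.

(** A linear inequality is a cone of rank 0. *)
Lemma socp_set_ge0 f : affine f -> socp_set 1 (fun x => 0 <= f x).
Proof.
move=> fA; apply: eq_socp_set
  (@socp_set_cone 0 (fun _ _ => 0) f _ fA) _ => [[]//|x].
by rewrite big_ord0 sqrtr0.
Qed.

Lemma socp_set_le f g : affine f -> affine g -> socp_set 1 (fun x => f x <= g x).
Proof.
move=> fA gA; apply: eq_socp_set (socp_set_ge0 (affineB gA fA)) _ => x.
by rewrite subr_ge0.
Qed.

Lemma socp_set_eq f g : affine f -> affine g -> socp_set 2 (fun x => f x = g x).
Proof.
move=> fA gA.
apply: eq_socp_set (socp_set_and (socp_set_le fA gA) (socp_set_le gA fA)) _ => x.
by split=> [->|[? ?]]; [split | apply/le_anti/andP].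
Qed.

End SocpSets.

(** * The size of the conic program *)

Lemma counterpart_is_socp (R : realType) (n D s1 s2 L : nat)
    (I : sbm_data R n D s1 s2 L) (k : 'I_n)
    (OmegaD : 'I_s1 -> R) (OmegaU : 'I_s2 -> R) (Omega : 'I_D -> R) :
  (forall r, 0 <= OmegaD r) ->
  (forall r, 0 <= OmegaU r) ->
  (forall d, 0 <= Omega d) ->
  is_socp_of_size (24 * (n + D + s1 + s2 + L + 1) ^ 3)%N
    (ellipsoidal_counterpart I k OmegaD OmegaU Omega).
Proof.
move=> OD0 OU0 O0.
pose phi := @sbm_coords R n D s1 s2.
have coordE i (f : sbm_vars R n D s1 s2 -> R) :
    (forall x, phi x 0 i = f x) -> affine phi f.
  by move=> /eq_affine; apply; apply: affine_coord.
have wA : affine phi (@var_w R n D s1 s2).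
  by apply: (coordE (lshift _ 0)) => x; rewrite row_mxEl mxE.
have pA : affine phi (@var_p2 R n D s1 s2).
  by apply: (coordE (rshift _ (lshift _ 0))) => x; rewrite row_mxEr row_mxEl mxE.
have lamA j : affine phi (fun x => var_lam x j).
  apply: (coordE (rshift _ (rshift _ (lshift _ j)))) => x.
  by rewrite !row_mxEr row_mxEl mxE.
have SA j : affine phi (fun x => var_S x j).
  apply: (coordE (rshift _ (rshift _ (rshift _ (lshift _ j))))) => x.
  by rewrite !row_mxEr row_mxEl mxE.
have bA j : affine phi (fun x => var_b x j).
  apply: (coordE (rshift _ (rshift _ (rshift _ (rshift _ (lshift _ j)))))) => x.
  by rewrite !row_mxEr row_mxEl mxE.
have SDA j : affine phi (fun x => var_SD x j).
  apply: (coordE (rshift _ (rshift _ (rshift _ (rshift _ (rshift _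
    (lshift _ j))))))) => x.
  by rewrite !row_mxEr row_mxEl mxE.
have cDA j : affine phi (fun x => var_cD x j).
  apply: (coordE (rshift _ (rshift _ (rshift _ (rshift _ (rshift _ (rshift _
    (lshift _ j)))))))) => x.
  by rewrite !row_mxEr row_mxEl mxE.
have SUA j : affine phi (fun x => var_SU x j).
  apply: (coordE (rshift _ (rshift _ (rshift _ (rshift _ (rshift _ (rshift _
    (rshift _ (lshift _ j))))))))) => x.
  by rewrite !row_mxEr row_mxEl mxE.
have cUA j : affine phi (fun x => var_cU x j).
  apply: (coordE (rshift _ (rshift _ (rshift _ (rshift _ (rshift _ (rshift _
    (rshift _ (rshift _ j))))))))) => x.
  by rewrite !row_mxEr mxE.
have [B leB [cones [strict [szB FE]]]] : exists2 B,
    (B <= 7 * (n + D + s1 + s2 + L + 1) ^ 2)%N &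
    socp_set phi B (feasible (ellipsoidal_counterpart I k OmegaD OmegaU Omega)).
  (* The cost is found by unification while the constraints are collected. *)
  eexists; last first.
  { (* The feasible set is a match on [x], which reduces once [x] is rebuilt
       from its fields. *)
    apply: (@eq_socp_set _ _ _ phi _ (fun x =>
      feasible (ellipsoidal_counterpart I k OmegaD OmegaU Omega)
        (SBMVars (var_w x) (var_p2 x) (var_lam x) (var_S x) (var_b x)
                 (var_SD x) (var_cD x) (var_SU x) (var_cU x)))); last by case.
    rewrite /=.
    repeat apply: socp_set_and.
    all: try (apply: socp_set_forall => ?).
    all: first [apply: socp_set_robust => // | apply: socp_set_le
      | apply: socp_set_eq | apply: socp_set_gt0].
    all: repeat first [exact: wA | exact: pA | exact: lamA | exact: SA | exact: bA
      | exact: SDA | exact: cDA | exact: SUA | exact: cUA | apply: affine_const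
      | apply: affineB | apply: affineD | apply: affineN | apply: affine_sum => ?
      | apply: affineMl | apply: affineMr | move=> ?]. }
  (* The cost is [5 + n + m + 2 m (L + 1)] with [m = D + s1 + s2]. *)
  set T := (n + D + s1 + s2 + L + 1)%N.
  have leT : (T <= T ^ 2)%N by rewrite -mulnn leq_pmulr // /T addn1.
  have : ((D + s1 + s2) * L.+1 <= T ^ 2)%N by rewrite -mulnn leq_mul // /T; lia.
  by rewrite /T in leT *; lia.
set T := (n + D + s1 + s2 + L + 1)%N in leB *.
pose obj : 'cV[R]_(sbm_dim n D s1 s2) := delta_mx (lshift _ 0) 0.
exists (SOCP obj cones strict) => [|x]; last first.
  split; last exact: FE.
  by rewrite /= -colE mxE row_mxEl mxE.
have -> : socp_size (SOCP obj cones strict) = (sbm_dim n D s1 s2 +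
    (\sum_(C <- cones) (soc_rank C).+1 + size strict) * (sbm_dim n D s1 s2).+1)%N.
  by rewrite /socp_size /= mulnDl big_distrl addnA.
(* With at most [3 T] variables, counting the constant as one, the program has
   at most [3 T + 7 T ^ 2 * 3 T <= 24 T ^ 3] coefficients. *)
have dimT : ((sbm_dim n D s1 s2).+1 <= 3 * T)%N by rewrite /sbm_dim /T; lia.
have leT : (T <= T ^ 3)%N by rewrite expnS leq_pmulr // expn_gt0 /T addn1.
have rowsT := leq_mul (leq_trans szB leB) dimT.
have TE : (7 * T ^ 2 * (3 * T) = 21 * T ^ 3)%N by ring.
rewrite TE in rowsT; lia.
Qed.

Theorem theorem6 (R : realType) :
  exists C e : nat,
    forall (n D s1 s2 L : nat) (I : sbm_data R n D s1 s2 L) (k : 'I_n)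
      (OmegaD : 'I_s1 -> R) (OmegaU : 'I_s2 -> R) (Omega : 'I_D -> R),
    (forall r, 0 <= OmegaD r) ->
    (forall r, 0 <= OmegaU r) ->
    (forall d, 0 <= Omega d) ->
    equivalent_problems
      (robust_sbm I k (fun r => @ball2 R L (OmegaD r))
                      (fun r => @ball2 R L (OmegaU r))
                      (fun d => @ball2 R L (Omega d)))
      (ellipsoidal_counterpart I k OmegaD OmegaU Omega)
    /\ is_socp_of_size (C * (n + D + s1 + s2 + L + 1) ^ e)%N
         (ellipsoidal_counterpart I k OmegaD OmegaU Omega).
Proof.
exists 24, 3 => n D s1 s2 L I k OmegaD OmegaU Omega OD0 OU0 O0.
by split; [apply: robust_sbm_counterpart | apply: counterpart_is_socp].
Qed.
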